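(* Let $A$ be a finite dimensional weak $C^*$-Hopf algebra and $M$ an $A$-module algebra. For $n\in M$ the following conditions are equivalent: (i) $a\triangleright(mn)=(a\triangleright m)n$ for all $a\in A$, $m\in M$; (ii) $a\triangleright n=a_{(1)}S(a_{(2)})\triangleright n\equiv\varepsilon(1_{(1)}a)1_{(2)}\triangleright n$ for all $a\in A$; (iii) $a\triangleright(nm)=n(a\triangleright m)$ for all $a\in A$, $m\in M$; (iv) $a\triangleright n=a_{(2)}S^{-1}(a_{(1)})\triangleright n\equiv\varepsilon(1_{(2)}a)1_{(1)}\triangleright n$ for all $a\in A$.
   Context: A finite dimensional weak $C^*$-Hopf algebra is a finite dimensional $C^*$-algebra $A$ (unit $1$) with linear maps $\Delta:A\to A\otimes A$, $\varepsilon:A\to\mathbb C$, $S:A\to A$ such that, for all $x,y,z\in A$ in Sweedler notation: $\Delta(xy)=\Delta(x)\Delta(y)$; $\Delta(x^* )=\Delta(x)^*$; $(\Delta\otimes\mathrm{id})\Delta=(\mathrm{id}\otimes\Delta)\Delta$; $(\Delta(1)\otimes1)(1\otimes\Delta(1))=1_{(1)}\otimes1_{(2)}\otimes1_{(3)}$; $(\varepsilon\otimes\mathrm{id})\Delta=\mathrm{id}=(\mathrm{id}\otimes\varepsilon)\Delta$; $\varepsilon(xyz)=\varepsilon(xy_{(1)})\varepsilon(y_{(2)}z)$; $S(x_{(1)})x_{(2)}=1_{(1)}\varepsilon(x1_{(2)})$; $x_{(1)}S(x_{(2)})=\varepsilon(1_{(1)}x)1_{(2)}$; $S(x_{(1)})x_{(2)}S(x_{(3)})=S(x)$.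 ($\Delta(1)\neq 1\otimes 1$ in general; $S$ is automatically invertible.) Put $x_*:=S(x)^*$. An $A$-module algebra is a unital $*$-algebra $M$ with a linear left action $\triangleright:A\otimes M\to M$ such that $(ab)\triangleright m=a\triangleright(b\triangleright m)$, $1\triangleright m=m$, $a\triangleright(mn)=(a_{(1)}\triangleright m)(a_{(2)}\triangleright n)$, $(a\triangleright m)^*=a_*\triangleright m^*$, $a\triangleright1_M=(a_{(1)}S(a_{(2)}))\triangleright1_M$ for all $a,b\in A$, $m,n\in M$. *)

(* Defs.v *)
From HB Require Import structures.
From mathcomp Require Import all_boot all_order all_algebra.
From mathcomp Require Import falgebra complex reals.

Set Implicit Arguments.
Unset Strict Implicit.
Unset Printing Implicit Defensive.

Import Order.TTheory GRing.Theory Num.Theory.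
Local Open Scope ring_scope.

Reserved Notation "u \ox v" (at level 40, left associativity).
Reserved Notation "\tsum_ ( a , b <- t ) E"
  (at level 41, E at level 41, a name, b name, t at level 50,
   format "'[' \tsum_ ( a ,  b  <-  t ) '/  '  E ']'").
Reserved Notation "a |> m" (at level 45, right associativity).

(* The tensor product of finite dimensional spaces is realised as the space of
   coordinate matrices over the pairs of vectors of the bases vbasis {:U} and
   vbasis {:V}; tlift_pure and tensor_span are its universal property. *)
Section Tensor.
Variable F : fieldType.

Definition tensor (U V : vectType F) : vectType F :=
  'M[F]_(\dim {:U}, \dim {:V}).

Definition pure (U V : vectType F) (u : U) (v : V) : tensor U V :=
  \matrix_(i, j) (coord (vbasis {:U}) i u * coord (vbasis {:V}) j v).

(* The linear map on U (x) V attached to a bilinear f. *)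
Definition tlift (U V : vectType F) (W : lmodType F) (f : U -> V -> W)
    (t : tensor U V) : W :=
  \sum_i \sum_j (t : 'M_(_, _)) i j *: f (vbasis {:U})`_i (vbasis {:V})`_j.

End Tensor.

Notation "u \ox v" := (pure u v) : ring_scope.

(* Sweedler notation: with t = Delta(x), E(x_(1), x_(2)) is written
   \tsum_(a, b <- t) E a b. The expression E must be bilinear in (a, b). *)
Notation "\tsum_ ( a , b <- t ) E" := (tlift (fun a b => E) t) : ring_scope.

Section TensorTheory.
Variables (F : fieldType) (U V : vectType F).

Lemma tlift_pure (W : lmodType F) (f : U -> V -> W) (u : U) (v : V) :
    (forall v, linear (f^~ v)) -> (forall u, linear (f u)) ->
  tlift f (u \ox v) = f u v.
Proof.
move=> fl fr.
pose gl v := HB.pack_for {linear U -> W} (f^~ v)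
  (GRing.isLinear.Build _ _ _ _ _ (fl v)).
pose gr u := HB.pack_for {linear V -> W} (f u)
  (GRing.isLinear.Build _ _ _ _ _ (fr u)).
have hu := coord_vbasis (memvf u).
have hv := coord_vbasis (memvf v).
rewrite {2}hu -[RHS]/(gl v _) linear_sum; apply: eq_bigr => i _.
rewrite linearZ /= {2}hv -[f _ _]/(gr _ _) linear_sum scaler_sumr.
by apply: eq_bigr => j _; rewrite linearZ /= scalerA /pure mxE.
Qed.

Lemma tensor_span (t : tensor U V) : t = \tsum_(a, b <- t) (a \ox b).
Proof.
apply/matrixP => k l; rewrite /tlift summxE (bigD1 k) //= summxE (bigD1 l) //=.
have fU : free (vbasis {:U}) by exact: basis_free (vbasisP _).
have fV : free (vbasis {:V}) by exact: basis_free (vbasisP _).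
rewrite !mxE !coord_free // !eqxx !mulr1 !big1 ?addr0 //.
  move=> i ik; rewrite summxE big1 // => j _.
  by rewrite !mxE !coord_free // (negPf ik) mul0r mulr0.
by move=> j jl; rewrite !mxE !coord_free // (negPf jl) !mulr0.
Qed.

Lemma pure_linearl (v : V) : linear (fun u : U => u \ox v).
Proof. by move=> c x y; apply/matrixP=> i j; rewrite !mxE linearP mulrDl mulrA. Qed.

Lemma pure_linearr (u : U) : linear (fun v : V => u \ox v).
Proof. by move=> c x y; apply/matrixP=> i j; rewrite !mxE linearP mulrDr mulrCA. Qed.

Lemma tlift_linear (W : lmodType F) (f : U -> V -> W) : linear (tlift f).
Proof.
move=> c s t; rewrite /tlift scaler_sumr -big_split; apply: eq_bigr => i _ /=.
rewrite scaler_sumr -big_split; apply: eq_bigr => j _ /=.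
by rewrite !mxE scalerDl scalerA.
Qed.

End TensorTheory.

HB.mixin Record isStarAlgebra (R : rcfType) A of GRing.Algebra R[i] A := {
  star : A -> A;
  starD : forall x y : A, star (x + y) = star x + star y;
  starZ : forall (c : R[i]) (x : A), star (c *: x) = c^* *: star x;
  starM : forall x y : A, star (x * y) = star y * star x;
  starK : forall x : A, star (star x) = x
}.

#[short(type="starAlgType")]
HB.structure Definition StarAlgebra (R : rcfType) :=
  {A of GRing.Algebra R[i] A & isStarAlgebra R A}.

HB.mixin Record isCstarNormed (R : realType) A of StarAlgebra R A := {
  cnorm : A -> R;
  cnormD : forall x y : A, cnorm (x + y) <= cnorm x + cnorm y;
  cnormZ : forall (c : R[i]) (x : A),
    (cnorm (c *: x))%:C%C = `|c| * (cnorm x)%:C%C;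
  cnorm0_eq0 : forall x : A, cnorm x = 0 -> x = 0;
  cnormM : forall x y : A, cnorm (x * y) <= cnorm x * cnorm y;
  cnorm_star : forall x : A, cnorm (star x * x) = cnorm x ^+ 2
}.

(* Completeness of the norm is automatic in finite dimension. *)
#[short(type="finDimCstarAlgType")]
HB.structure Definition FinDimCstarAlgebra (R : realType) :=
  {A of StarAlgebra R A & Falgebra R[i] A & isCstarNormed R A}.

Section TensorStarAlgebra.
Variables (R : realType) (A : finDimCstarAlgType R).

Definition tmul (s t : tensor A A) : tensor A A :=
  \tsum_(a, b <- s) \tsum_(c, d <- t) ((a * c) \ox (b * d)).

(* tlift is linear, so the coordinates are conjugated beforehand. *)
Definition tstar (s : tensor A A) : tensor A A :=
  \tsum_(a, b <- map_mx Num.conj s) (star a \ox star b).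

Lemma tmul_pure (a b c d : A) : tmul (a \ox b) (c \ox d) = (a * c) \ox (b * d).
Proof.
have H a' b' : \tsum_(c', d' <- c \ox d) ((a' * c') \ox (b' * d')) = (a' * c) \ox (b' * d) :> tensor A A.
  rewrite tlift_pure // => [v|u] k x y.
    by rewrite mulrDr -scalerAr pure_linearl.
  by rewrite mulrDr -scalerAr pure_linearr.
rewrite /tmul tlift_pure => [|v|u]; rewrite ?H // => k x y; rewrite !H.
  by rewrite mulrDl -scalerAl pure_linearl.
by rewrite mulrDl -scalerAl pure_linearr.
Qed.

Lemma star0 : star (0 : A) = 0.
Proof. by apply: (addrI (star 0)); rewrite -starD !addr0. Qed.

Lemma star_sum I (r : seq I) (G : I -> A) : star (\sum_(i <- r) G i) = \sum_(i <- r) star (G i).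
Proof. by apply: (big_morph _ (@starD R A) star0). Qed.

Lemma tstar_pure (a b : A) : tstar (a \ox b) = star a \ox star b.
Proof.
pose pl (v : A) := HB.pack_for {linear A -> tensor A A} (fun u => u \ox v) (GRing.isLinear.Build _ _ _ _ _ (pure_linearl v)).
pose pr (v : A) := HB.pack_for {linear A -> tensor A A} (fun u => v \ox u) (GRing.isLinear.Build _ _ _ _ _ (pure_linearr v)).
rewrite {2}(coord_vbasis (memvf a)) star_sum -[RHS]/(pl (star b) _) linear_sum.
rewrite /tstar/tlift; apply: eq_bigr => i _.
rewrite starZ linearZ /= {2}(coord_vbasis (memvf b)) star_sum.
rewrite -[X in _ = _ *: X]/(pr (star (vbasis {:A})`_i) _).
rewrite linear_sum scaler_sumr; apply: eq_bigr => j _ .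
by rewrite starZ linearZ scalerA !mxE rmorphM.
Qed.

End TensorStarAlgebra.

(* A (x) A (x) A is A (x) (A (x) A), and in comul1
   (Delta(1) (x) 1)(1 (x) Delta(1)) is multiplied out as
   1_(1) (x) 1_(2)1_(1') (x) 1_(2'). That antipode is bijective follows from the
   axioms, so (antipode^-1)%VF is its two-sided inverse. *)
HB.mixin Record isWeakHopf (R : realType) A of FinDimCstarAlgebra R A := {
  comul : 'Hom(A, tensor A A);
  counit : {scalar A};
  antipode : 'End(A);
  comulM : forall x y : A, comul (x * y) = tmul (comul x) (comul y);
  comul_star : forall x : A, comul (star x) = tstar (comul x);
  comulA : forall x : A,
    \tsum_(a, b <- comul x) \tsum_(a1, a2 <- comul a) (a1 \ox (a2 \ox b)) =
    \tsum_(a, b <- comul x) \tsum_(b1, b2 <- comul b) (a \ox (b1 \ox b2));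
  comul1 :
    \tsum_(a, b <- comul 1) \tsum_(c, d <- comul 1) (a \ox ((b * c) \ox d)) =
    \tsum_(a, b <- comul 1) \tsum_(b1, b2 <- comul b) (a \ox (b1 \ox b2));
  counitl : forall x : A, \tsum_(a, b <- comul x) (counit a *: b) = x;
  counitr : forall x : A, \tsum_(a, b <- comul x) (counit b *: a) = x;
  counitM : forall x y z : A,
    counit (x * y * z) =
    \tsum_(a, b <- comul y) (counit (x * a) * counit (b * z) : R[i]^o);
  antipodel : forall x : A,
    \tsum_(a, b <- comul x) (antipode a * b) =
    \tsum_(a, b <- comul 1) (counit (x * b) *: a);
  antipoder : forall x : A,
    \tsum_(a, b <- comul x) (a * antipode b) =
    \tsum_(a, b <- comul 1) (counit (a * x) *: b);
  antipodelr : forall x : A,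
    \tsum_(a, b <- comul x) \tsum_(b1, b2 <- comul b)
      (antipode a * b1 * antipode b2) = antipode x
}.

#[short(type="weakCstarHopfType")]
HB.structure Definition WeakCstarHopf (R : realType) :=
  {A of FinDimCstarAlgebra R A & isWeakHopf R A}.

(* x_* = S(x)^* *)
Definition lowerstar (R : realType) (A : weakCstarHopfType R) (x : A) : A :=
  star (antipode x).

HB.mixin Record isModuleAlgebra (R : realType) (A : weakCstarHopfType R) M
    of StarAlgebra R M := {
  hact : A -> M -> M;
  hact_linearl : forall m : M, linear (hact^~ m);
  hact_linearr : forall a : A, linear (hact a);
  hactM : forall (a b : A) (m : M), hact (a * b) m = hact a (hact b m);
  hact1 : forall m : M, hact 1 m = m;
  hact_mul : forall (a : A) (m n : M),
    hact a (m * n) = \tsum_(a1, a2 <- comul a) (hact a1 m * hact a2 n);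
  hact_star : forall (a : A) (m : M), star (hact a m) = hact (lowerstar a) (star m);
  hact_one : forall a : A,
    hact a 1 = hact (\tsum_(a1, a2 <- comul a) (a1 * antipode a2)) 1
}.

#[short(type="moduleAlgebraType")]
HB.structure Definition ModuleAlgebra (R : realType) (A : weakCstarHopfType R) :=
  {M of StarAlgebra R M & isModuleAlgebra R A M}.

Notation "a |> m" := (hact a m) : ring_scope.

(* Main.v *)
(* Write piL(x) = eps(1_(1) x) 1_(2) and opiR(x) = eps(1_(2) x) 1_(1).  The
   identities a_(1) (x) piL(a_(2)) = 1_(1) a (x) 1_(2) and
   opiR(a_(1)) (x) a_(2) = 1_(1) (x) 1_(2) a give (ii) => (i) and
   (iv) => (iii).  Conversely (i) and (iii) at m = 1 move the action onto 1,
   where a, piL(a) and opiR(a) act alike because piL(opiR(a)) = piL(a); so each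
   of (i), (iii) implies both (ii) and (iv).  The remaining point is that
   a_(2) S^-1(a_(1)) = opiR(a).  Conjugating the antipode axioms shows it for
   T(x) = S(x^* )^* in place of S^-1, and S(T(x)) = x because S is
   antimultiplicative and S(opiR(x)) = piL(x); finite dimension then gives
   T = S^-1. *)
Require Import Defs.
From HB Require Import structures.
From mathcomp Require Import all_boot all_order all_algebra.
From mathcomp Require Import falgebra complex reals.

Set Implicit Arguments.
Unset Strict Implicit.
Unset Printing Implicit Defensive.

Import Order.TTheory GRing.Theory Num.Theory.
Local Open Scope ring_scope.

(** * Linearity of plain functions, without bundled structures *)

Section LinearFunctions.
Variables (K : comPzRingType) (U V W : lmodType K).

Lemma linear_idfun : linear (fun x : U => x).
Proof. by []. Qed.

Lemma linear_comp (g : V -> W) (f : U -> V) :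
  linear g -> linear f -> linear (fun x => g (f x)).
Proof. by move=> gL fL k x y; rewrite fL gL. Qed.

Lemma scalar_comp (g : V -> K) (f : U -> V) :
  scalar g -> linear f -> scalar (fun x => g (f x)).
Proof. by move=> gL fL k x y; rewrite fL gL. Qed.

Lemma linear_scalel (s : U -> K) (w : W) :
  scalar s -> linear (fun x => s x *: w).
Proof. by move=> sL k x y; rewrite sL scalerDl -scalerA. Qed.

Lemma linear_scaler (c : K) (f : U -> W) :
  linear f -> linear (fun x => c *: f x).
Proof. by move=> fL k x y; rewrite fL scalerDr !scalerA mulrC. Qed.

Lemma linear_bigsum (I : finType) (f : U -> I -> W) :
  (forall i, linear (f^~ i)) -> linear (fun x => \sum_i f x i).
Proof.
move=> fL k x y; rewrite scaler_sumr -big_split.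
by apply: eq_bigr => i _; apply: fL.
Qed.

Lemma linear_fun0 (f : U -> V) : linear f -> f 0 = 0.
Proof.
move=> fL; have /eqP := fL 1 0 0; rewrite !scale1r addr0.
by rewrite -subr_eq subrr eq_sym => /eqP.
Qed.

Lemma linear_funZ (f : U -> V) :
  linear f -> forall k x, f (k *: x) = k *: f x.
Proof. by move=> fL k x; rewrite -[k *: x]addr0 fL linear_fun0 // addr0. Qed.

Lemma linear_fun_sum (f : U -> V) : linear f ->
  forall I (r : seq I) (G : I -> U),
  f (\sum_(i <- r) G i) = \sum_(i <- r) f (G i).
Proof.
move=> fL I r G; apply: (big_morph f) => [x y|]; last exact: linear_fun0.
by have := fL 1 x y; rewrite !scale1r.
Qed.

End LinearFunctions.

Lemma linear_mull (K : pzRingType) (U : lmodType K) (B : algType K)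
    (f : U -> B) (b : B) : linear f -> linear (fun x => f x * b).
Proof. by move=> fL k x y; rewrite fL mulrDl scalerAl. Qed.

Lemma linear_mulr (K : pzRingType) (U : lmodType K) (B : algType K)
    (f : U -> B) (b : B) : linear f -> linear (fun x => b * f x).
Proof. by move=> fL k x y; rewrite fL mulrDr scalerAr. Qed.

(* A comultiplication x |-> sum_i cmull i x (x) cmulr i, read as in a fixed
   basis (cmulr i) of the right tensor factor. *)
Record comultiplication (K : fieldType) (A : algType K) := Comultiplication {
  cmul_ix : finType;
  cmull : cmul_ix -> A -> A;
  cmulr : cmul_ix -> A;
  linear_cmull : forall i, linear (cmull i)
}.

Definition sweedler (K : fieldType) (A : algType K) (D : comultiplication A)
    (W : lmodType K) (f : A -> A -> W) (x : A) : W :=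
  \sum_(i : cmul_ix D) f (cmull i x) (cmulr i).

Reserved Notation "\sw_ ( a , b <- x ) E"
  (at level 41, E at level 41, a name, b name, x at level 50,
   format "'[' \sw_ ( a ,  b  <-  x ) '/  '  E ']'").

(** * Calculus of Sweedler sums *)

Section Sweedler.
Variables (K : fieldType) (A : algType K) (D : comultiplication A).
Local Notation "\sw_ ( a , b <- x ) E" := (sweedler D (fun a b => E) x).
Implicit Types W : lmodType K.

Lemma eq_sweedler W (f g : A -> A -> W) x :
  (forall a b, f a b = g a b) -> \sw_(a, b <- x) f a b = \sw_(a, b <- x) g a b.
Proof. by move=> fg; apply: eq_bigr => i _; apply: fg. Qed.

Lemma linear_sweedler (U W : lmodType K) (f : A -> A -> W) (g : U -> A) :
  (forall b, linear (f^~ b)) -> linear g ->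
  linear (fun x => \sw_(a, b <- g x) f a b).
Proof.
move=> fL gL; apply: linear_bigsum => i.
by apply: (linear_comp (fL _)) => k x y; rewrite gL linear_cmull.
Qed.

Lemma linear_sweedler_body (U W : lmodType K) (f : U -> A -> A -> W) x :
  (forall a b, linear (fun u => f u a b)) ->
  linear (fun u => \sw_(a, b <- x) f u a b).
Proof. by move=> fL; apply: linear_bigsum => i; apply: fL. Qed.

Lemma sweedler_comp W W' (g : W -> W') (f : A -> A -> W) x :
  linear g -> g (\sw_(a, b <- x) f a b) = \sw_(a, b <- x) g (f a b).
Proof. by move=> gL; apply: linear_fun_sum. Qed.

Lemma exchange_sweedler W (f : A -> A -> A -> A -> W) x y :
  \sw_(a, b <- x) \sw_(c, d <- y) f a b c d =
  \sw_(c, d <- y) \sw_(a, b <- x) f a b c d.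
Proof. exact: exchange_big. Qed.

End Sweedler.

(** * Weak Hopf algebras through multilinear test functions *)

Section WeakHopfAxioms.
Variables (K : fieldType) (A : algType K) (D : comultiplication A).
Variables (eps : A -> K) (S : A -> A).
Local Notation "\sw_ ( a , b <- x ) E" := (sweedler D (fun a b => E) x).

(** These are the four counital maps. [opi_r] and [opi_l] are [pi_l] and [pi_r] for the co-opposite
    comultiplication. In the star setting, [opi_l] and [opi_r] are also the conjugates of [pi_l] and
    [pi_r] by the star. *)
Definition pi_l (x : A) : A := \sw_(u, v <- 1) (eps (u * x) *: v).
Definition pi_r (x : A) : A := \sw_(u, v <- 1) (eps (x * v) *: u).
Definition opi_l (x : A) : A := \sw_(u, v <- 1) (eps (x * u) *: v).
Definition opi_r (x : A) : A := \sw_(u, v <- 1) (eps (v * x) *: u).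

(* Identities between elements of A (x) A or A (x) A (x) A are expressed by
   applying every multilinear f to both sides.  The fields wh_comul1r and
   wh_counitMr have their tensor factors in the order opposite to the axioms;
   there they come from the star operation. *)
Record weak_hopf : Prop := WeakHopf {
  wh_eps : scalar eps;
  wh_antipode : linear S;
  wh_comulM : forall (W : lmodType K) (f : A -> A -> W) x y,
    (forall b, linear (f^~ b)) -> (forall a, linear (f a)) ->
    \sw_(a, b <- x * y) f a b =
    \sw_(a, b <- x) \sw_(c, d <- y) f (a * c) (b * d);
  wh_comulA : forall (W : lmodType K) (f : A -> A -> A -> W) x,
    (forall b c, linear (fun a => f a b c)) ->
    (forall a c, linear (fun b => f a b c)) ->
    (forall a b, linear (f a b)) ->
    \sw_(a, b <- x) \sw_(a1, a2 <- a) f a1 a2 b =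
    \sw_(a, b <- x) \sw_(b1, b2 <- b) f a b1 b2;
  wh_comul1 : forall (W : lmodType K) (f : A -> A -> A -> W),
    (forall b c, linear (fun a => f a b c)) ->
    (forall a c, linear (fun b => f a b c)) ->
    (forall a b, linear (f a b)) ->
    \sw_(a, b <- 1) \sw_(c, d <- 1) f a (b * c) d =
    \sw_(a, b <- 1) \sw_(b1, b2 <- b) f a b1 b2;
  wh_comul1r : forall (W : lmodType K) (f : A -> A -> A -> W),
    (forall b c, linear (fun a => f a b c)) ->
    (forall a c, linear (fun b => f a b c)) ->
    (forall a b, linear (f a b)) ->
    \sw_(a, b <- 1) \sw_(c, d <- 1) f a (c * b) d =
    \sw_(a, b <- 1) \sw_(b1, b2 <- b) f a b1 b2;
  wh_counitl : forall x, \sw_(a, b <- x) (eps a *: b) = x;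
  wh_counitr : forall x, \sw_(a, b <- x) (eps b *: a) = x;
  wh_counitM : forall x z,
    \sw_(a, b <- 1) (eps (x * a) * eps (b * z) : K^o) = eps (x * z);
  wh_counitMr : forall x z,
    \sw_(a, b <- 1) (eps (x * b) * eps (a * z) : K^o) = eps (x * z);
  wh_antipodel : forall x, \sw_(a, b <- x) (S a * b) = pi_r x;
  wh_antipoder : forall x, \sw_(a, b <- x) (a * S b) = pi_l x;
  wh_antipodelr : forall x,
    \sw_(a, b <- x) \sw_(b1, b2 <- b) (S a * b1 * S b2) = S x
}.

End WeakHopfAxioms.

(* The last branches peel a linear map off the body of f, using a linearity
   hypothesis found in the context. *)
Ltac lin := intros; lazymatch goal with
  | |- GRing.linear_for _ ?f => lazymatch f with
    | fun x => x => exact: linear_idfun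
    | fun x => sweedler _ _ _ =>
       first [apply: linear_sweedler_body; lin | apply: linear_sweedler; lin]
    | fun x => _ *: _ =>
       first [apply: linear_scaler; lin | apply: linear_scalel; lin]
    | fun x => _ * _ =>
       first [apply: linear_mull; lin | apply: linear_mulr; lin]
    | fun x => pi_l _ _ _ => apply: linear_sweedler_body; lin
    | fun x => pi_r _ _ _ => apply: linear_sweedler_body; lin
    | fun x => opi_l _ _ _ => apply: linear_sweedler_body; lin
    | fun x => opi_r _ _ _ => apply: linear_sweedler_body; lin
    | GRing.mul _ => apply: linear_mulr; lin
    | GRing.scale _ => apply: linear_scaler; lin
    | _ => first [assumption | eassumption | match goal with
        | H : _ |- _ => refine (linear_comp H _); lin
        | H : _ |- _ => refine (scalar_comp H _); lin
        | H : _ |- _ => refine (linear_comp (H _) _); lin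
        | H : _ |- _ => refine (linear_comp (H _ _) _); lin end]
    end
  end.

(** * Counital maps of a weak Hopf algebra *)

Section WeakHopfTheory.
Variables (K : fieldType) (A : algType K) (D : comultiplication A).
Variables (eps : A -> K) (S : A -> A).
Hypothesis AH : weak_hopf D eps S.
Local Notation "\sw_ ( a , b <- x ) E" := (sweedler D (fun a b => E) x).
Local Notation piL := (pi_l D eps).
Local Notation piR := (pi_r D eps).
Local Notation opiL := (opi_l D eps).
Local Notation opiR := (opi_r D eps).
Implicit Types (W : lmodType K) (x y z : A).

(** These linearity facts are kept in the context because [lin] searches there. *)
Let epsL : scalar eps := wh_eps AH.
Let SL : linear S := wh_antipode AH.
Let piLL : linear piL. Proof. by apply: linear_sweedler_body; lin. Qed.
Let piRL : linear piR. Proof. by apply: linear_sweedler_body; lin. Qed.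
Let opiLL : linear opiL. Proof. by apply: linear_sweedler_body; lin. Qed.
Let opiRL : linear opiR. Proof. by apply: linear_sweedler_body; lin. Qed.

Section BilinearIdentities.
Variables (W : lmodType K) (f : A -> A -> W).
Hypothesis fl : forall b, linear (f^~ b).
Hypothesis fr : forall a, linear (f a).

Lemma sweedler_mul1l x :
  \sw_(u, v <- 1) \sw_(a, b <- x) f (u * a) (v * b) = \sw_(a, b <- x) f a b.
Proof. by rewrite -(wh_comulM AH) // mul1r. Qed.

Lemma sweedler_mul1r x :
  \sw_(a, b <- x) \sw_(u, v <- 1) f (a * u) (b * v) = \sw_(a, b <- x) f a b.
Proof. by rewrite -(wh_comulM AH) // mulr1. Qed.

Lemma sweedler_counitl (g : A -> W) x : linear g ->
  \sw_(a, b <- x) (eps a *: g b) = g x.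
Proof.
move=> gL; rewrite -{2}[x](wh_counitl AH) (sweedler_comp _ _ _ gL).
by apply: eq_sweedler => a b; rewrite (linear_funZ gL).
Qed.

Lemma sweedler_counitr (g : A -> W) x : linear g ->
  \sw_(a, b <- x) (eps b *: g a) = g x.
Proof.
move=> gL; rewrite -{2}[x](wh_counitr AH) (sweedler_comp _ _ _ gL).
by apply: eq_sweedler => a b; rewrite (linear_funZ gL).
Qed.

End BilinearIdentities.

(** Insert Delta(1) to the left of Delta(x). The reversed product (1 (x) Delta(1))(Delta(1) (x) 1)
    is the iterated coproduct of 1, so by coassociativity Delta(1_(1) x) appears, and the counit
    removes its second leg. *)
Lemma sweedler_pi_l W (f : A -> A -> W) x :
  (forall b, linear (f^~ b)) -> (forall a, linear (f a)) ->
  \sw_(a, b <- x) f a (piL b) = \sw_(u, v <- 1) f (u * x) v.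
Proof.
move=> fl fr.
rewrite -(sweedler_mul1l (f := fun a b => f a (piL b))); try by lin.
transitivity (\sw_(p, q <- 1) \sw_(u, v <- 1) \sw_(a, b <- x)
    (eps (u * q * b) *: f (p * a) v)).
  apply: eq_sweedler => p q; rewrite exchange_sweedler.
  apply: eq_sweedler => a b.
  rewrite /pi_l (sweedler_comp _ _ _ (fr _)); apply: eq_sweedler => u v.
  by rewrite mulrA (linear_funZ (fr _)).
rewrite (wh_comul1r AH (f := fun p r v : A =>
  \sw_(a, b <- x) (eps (r * b) *: f (p * a) v)));
  try by lin.
rewrite -(wh_comulA AH (f := fun p r v : A =>
  \sw_(a, b <- x) (eps (r * b) *: f (p * a) v)));
  try by lin.
apply: eq_sweedler => p v.
rewrite -(wh_comulM AH (f := fun c d : A => eps d *: f c v)); try by lin.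
by rewrite (sweedler_counitr _ (g := f^~ v)).
Qed.

(** As for [sweedler_pi_l], but with (Delta(1) (x) 1)(1 (x) Delta(1)): here Delta(1_(2) x) appears,
    and the counit removes its first leg. *)
Lemma sweedler_opi_r W (f : A -> A -> W) x :
  (forall b, linear (f^~ b)) -> (forall a, linear (f a)) ->
  \sw_(a, b <- x) f (opiR a) b = \sw_(u, v <- 1) f u (v * x).
Proof.
move=> fl fr.
rewrite -(sweedler_mul1l (f := fun a b => f (opiR a) b)); try by lin.
transitivity (\sw_(u, v <- 1) \sw_(p, q <- 1) \sw_(a, b <- x)
    (eps (v * p * a) *: f u (q * b))).
  rewrite [RHS]exchange_sweedler; apply: eq_sweedler => p q.
  rewrite [RHS]exchange_sweedler; apply: eq_sweedler => a b.
  rewrite /opi_r (sweedler_comp _ _ _ (fl _)); apply: eq_sweedler => u v.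
  by rewrite mulrA (linear_funZ (fl _)).
rewrite (wh_comul1 AH (f := fun u r q : A =>
  \sw_(a, b <- x) (eps (r * a) *: f u (q * b)))); try by lin.
apply: eq_sweedler => u v.
rewrite -(wh_comulM AH (f := fun c d : A => eps c *: f u d)); try by lin.
by rewrite (sweedler_counitl _ (g := f u)).
Qed.

(** Here Delta(1) is inserted to the right of Delta(x), so that Delta(x 1_(1)) appears. *)
Lemma sweedler_opi_l W (f : A -> A -> W) x :
  (forall b, linear (f^~ b)) -> (forall a, linear (f a)) ->
  \sw_(a, b <- x) f a (opiL b) = \sw_(u, v <- 1) f (x * u) v.
Proof.
move=> fl fr.
rewrite -(sweedler_mul1r (f := fun a b => f a (opiL b))); try by lin.
transitivity (\sw_(p, q <- 1) \sw_(u, v <- 1) \sw_(a, b <- x)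
    (eps (b * (q * u)) *: f (a * p) v)).
  rewrite exchange_sweedler; apply: eq_sweedler => p q.
  rewrite [RHS]exchange_sweedler; apply: eq_sweedler => a b.
  rewrite /opi_l (sweedler_comp _ _ _ (fr _)); apply: eq_sweedler => u v.
  by rewrite mulrA (linear_funZ (fr _)).
rewrite (wh_comul1 AH (f := fun p r v : A =>
  \sw_(a, b <- x) (eps (b * r) *: f (a * p) v))); try by lin.
rewrite -(wh_comulA AH (f := fun p r v : A =>
  \sw_(a, b <- x) (eps (b * r) *: f (a * p) v))); try by lin.
apply: eq_sweedler => p v.
rewrite exchange_sweedler.
rewrite -(wh_comulM AH (f := fun c d : A => eps d *: f c v)); try by lin.
by rewrite (sweedler_counitr _ (g := f^~ v)).
Qed.

(** Expanding piR gives the reversed product of two copies of Delta(1) with the counit on the middle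
    leg; that leg disappears. *)
Lemma sweedler1_pi_r W (f : A -> A -> W) :
  (forall b, linear (f^~ b)) -> (forall a, linear (f a)) ->
  \sw_(a, b <- 1) f (piR a) b = \sw_(u, v <- 1) f u v.
Proof.
move=> fl fr.
transitivity (\sw_(u, v <- 1) \sw_(a, b <- 1) (eps (a * v) *: f u b)).
  rewrite [RHS]exchange_sweedler; apply: eq_sweedler => a b.
  rewrite /pi_r (sweedler_comp _ _ _ (fl _)); apply: eq_sweedler => u v.
  by rewrite (linear_funZ (fl _)).
rewrite (wh_comul1r AH (f := fun u r b : A => eps r *: f u b)); try by lin.
by apply: eq_sweedler => u v; rewrite (sweedler_counitl _ (g := f u)).
Qed.

Lemma sweedler_scaler W (s : A -> A -> K) (w : W) x :
  \sw_(a, b <- x) (s a b *: w) = (\sw_(a, b <- x) (s a b : K^o)) *: w.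
Proof. by rewrite /sweedler scaler_suml. Qed.

(** Weak multiplicativity of the counit recombines eps(p 1_(1)) eps(1_(2) x) into eps(p x). *)
Lemma sweedler1_pi_l_opi x :
  \sw_(u, v <- 1) (eps (v * x) *: piL u) = piL x.
Proof.
transitivity (\sw_(p, q <- 1) \sw_(u, v <- 1)
    ((eps (p * u) * eps (v * x)) *: q)).
  rewrite exchange_sweedler; apply: eq_sweedler => u v.
  rewrite /pi_l (sweedler_comp _ _ _ (g := fun w => eps (v * x) *: w));
    last by lin.
  by apply: eq_sweedler => p q; rewrite scalerA mulrC.
by apply: eq_sweedler => p q; rewrite sweedler_scaler (wh_counitM AH).
Qed.

Lemma pi_l_opi_r x : piL (opiR x) = piL x.
Proof.
rewrite -[RHS]sweedler1_pi_l_opi {1}/opi_r (sweedler_comp _ _ _ piLL).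
by apply: eq_sweedler => u v; rewrite (linear_funZ piLL).
Qed.

(** This is piL(x piL(y)) = piL(x y) with the inner piL expanded. *)
Lemma sweedler1_pi_l_mul x y :
  \sw_(u, v <- 1) (eps (u * y) *: piL (x * v)) = piL (x * y).
Proof.
transitivity (\sw_(p, q <- 1) \sw_(u, v <- 1)
    ((eps (p * x * v) * eps (u * y)) *: q)).
  rewrite exchange_sweedler; apply: eq_sweedler => u v.
  rewrite /pi_l (sweedler_comp _ _ _ (g := fun w => eps (u * y) *: w));
    last by lin.
  by apply: eq_sweedler => p q; rewrite scalerA mulrC mulrA.
by apply: eq_sweedler => p q; rewrite sweedler_scaler (wh_counitMr AH) mulrA.
Qed.

(** This is piR(piR(x) y) = piR(x y) with the inner piR expanded. *)
Lemma sweedler1_pi_r_mul x y :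
  \sw_(u, v <- 1) (eps (x * v) *: piR (u * y)) = piR (x * y).
Proof.
transitivity (\sw_(p, q <- 1) \sw_(u, v <- 1)
    ((eps (x * v) * eps (u * (y * q))) *: p)).
  rewrite exchange_sweedler; apply: eq_sweedler => u v.
  rewrite /pi_r (sweedler_comp _ _ _ (g := fun w => eps (x * v) *: w));
    last by lin.
  by apply: eq_sweedler => p q; rewrite scalerA mulrA.
by apply: eq_sweedler => p q; rewrite sweedler_scaler (wh_counitMr AH) mulrA.
Qed.

(** On piL(y), left multiplication inside piL becomes the left adjoint action. Write piL(x y) as
    eps(1_(1) y) piL(x 1_(2)), expand the second factor by the antipode axiom, and split the
    resulting iterated coproduct of 1 into two copies of Delta(1): one rebuilds piL(y), the other is
    absorbed by Delta(x). *)
Lemma pi_l_mul x y : piL (x * y) = \sw_(a, b <- x) (a * piL y * S b).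
Proof.
rewrite -sweedler1_pi_l_mul.
rewrite -(sweedler_mul1r (f := fun a b => a * piL y * S b)); try by lin.
transitivity (\sw_(a, b <- x) \sw_(u, w <- 1) \sw_(v, q <- w)
   (eps (u * y) *: (a * v * S (b * q)))).
  rewrite exchange_sweedler; apply: eq_sweedler => u w.
  rewrite -(wh_antipoder AH).
  rewrite (wh_comulM AH (f := fun c d : A => c * S d)); try by lin.
  rewrite (sweedler_comp _ _ _ (g := fun z => eps (u * y) *: z)); last by lin.
  apply: eq_sweedler => a b.
  by rewrite (sweedler_comp _ _ _ (g := fun z => eps (u * y) *: z));
    last by lin.
apply: eq_sweedler => a b.
rewrite -(wh_comul1r AH (f := fun u r q : A =>
    eps (u * y) *: (a * r * S (b * q)))); try by lin.
rewrite exchange_sweedler; apply: eq_sweedler => p q.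
rewrite /pi_l (sweedler_comp _ _ _ (g := fun w => a * p * w * S (b * q)));
  last by lin.
by apply: eq_sweedler => u v; rewrite -scalerAr -scalerAl !mulrA.
Qed.

(** Mirror image of [pi_l_mul]: the right adjoint action of y on piR(x). *)
Lemma pi_r_mul x y : piR (x * y) = \sw_(a, b <- y) (S a * piR x * b).
Proof.
rewrite -sweedler1_pi_r_mul.
rewrite -(sweedler_mul1l (f := fun a b => S a * piR x * b)); try by lin.
rewrite [RHS]exchange_sweedler.
transitivity (\sw_(a, b <- y) \sw_(w, v <- 1) \sw_(p, u <- w)
   (eps (x * v) *: (S (p * a) * (u * b)))).
  rewrite exchange_sweedler; apply: eq_sweedler => w v.
  rewrite -(wh_antipodel AH).
  rewrite (wh_comulM AH (f := fun c d : A => S c * d)); try by lin.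
  rewrite exchange_sweedler.
  rewrite (sweedler_comp _ _ _ (g := fun z => eps (x * v) *: z)); last by lin.
  apply: eq_sweedler => a b.
  by rewrite (sweedler_comp _ _ _ (g := fun z => eps (x * v) *: z));
    last by lin.
apply: eq_sweedler => a b.
rewrite (wh_comulA AH (f := fun p u v : A =>
    eps (x * v) *: (S (p * a) * (u * b)))); try by lin.
rewrite -(wh_comul1r AH (f := fun p u v : A =>
    eps (x * v) *: (S (p * a) * (u * b)))); try by lin.
apply: eq_sweedler => p q.
rewrite /pi_r (sweedler_comp _ _ _ (g := fun w => S (p * a) * w * (q * b)));
  last by lin.
by apply: eq_sweedler => u v; rewrite -scalerAr -scalerAl !mulrA.
Qed.

(** Both orders of multiplying the second leg of one Delta(1) with the first leg of another give the
    middle leg of the iterated coproduct of 1. *)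
Lemma pi_r_pi_l_comm x y : piR x * piL y = piL y * piR x.
Proof.
rewrite /pi_r [LHS](sweedler_comp _ _ _ (g := fun w => w * piL y));
  last by lin.
rewrite [RHS](sweedler_comp _ _ _ (g := fun w => piL y * w)); last by lin.
transitivity (\sw_(p, q <- 1) \sw_(u, v <- 1)
    (eps (p * y) *: (eps (x * v) *: (u * q)))).
  rewrite exchange_sweedler; apply: eq_sweedler => u v.
  rewrite /pi_l (sweedler_comp _ _ _ (g := fun w => eps (x * v) *: u * w));
    last by lin.
  by apply: eq_sweedler => p q; rewrite -scalerAl -scalerAr !scalerA mulrC.
rewrite (wh_comul1r AH (f := fun p r v : A =>
  eps (p * y) *: (eps (x * v) *: r))); try by lin.
rewrite -(wh_comul1 AH (f := fun p r v : A =>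
  eps (p * y) *: (eps (x * v) *: r))); try by lin.
rewrite exchange_sweedler; apply: eq_sweedler => u v.
rewrite /pi_l (sweedler_comp _ _ _ (g := fun w => w * (eps (x * v) *: u)));
  last by lin.
by apply: eq_sweedler => p q; rewrite -scalerAl -scalerAr.
Qed.

(** * Antimultiplicativity and inversion of the antipode *)

Lemma pi_l1 : piL 1 = 1.
Proof.
rewrite -[RHS](wh_counitl AH).
by apply: eq_sweedler => u v; rewrite mulr1.
Qed.

Lemma sweedler_antipode_pi_l x : \sw_(a, b <- x) (S a * piL b) = S x.
Proof.
rewrite -[RHS](wh_antipodelr AH); apply: eq_sweedler => a b.
rewrite -(wh_antipoder AH) (sweedler_comp _ _ _ (g := fun y => S a * y));
  last by lin.
by apply: eq_sweedler => c d; rewrite mulrA.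
Qed.

Lemma sweedler_pi_r_antipode x : \sw_(a, b <- x) (piR a * S b) = S x.
Proof.
rewrite -[RHS](wh_antipodelr AH).
rewrite -(wh_comulA AH (f := fun a b c : A => S a * b * S c)); try by lin.
apply: eq_sweedler => a b.
by rewrite -(wh_antipodel AH) (sweedler_comp _ _ _ (g := fun y => y * S b));
  last by lin.
Qed.

(** The chain is S(x y) = S(x_(1)y_(1)) piL(x_(2)y_(2)) = S(x_(1)y_(1)) x_(2)y_(2) S(y_(3)) S(x_(3))
    = piR(x_(1)y_(1)) S(y_(2)) S(x_(2)) = S(y_(1)) piR(x_(1)) piL(y_(2)) S(x_(2)). Commuting the two
    middle factors leaves S(y) S(x). *)
Lemma antipodeM x y : S (x * y) = S y * S x.
Proof.
rewrite -sweedler_antipode_pi_l.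
rewrite (wh_comulM AH (f := fun a b : A => S a * piL b)); try by lin.
transitivity (\sw_(a, b <- x) \sw_(a1, a2 <- a) \sw_(c, d <- y)
    \sw_(c1, c2 <- c) (S (a1 * c1) * (a2 * c2) * (S d * S b))).
  rewrite (wh_comulA AH (f := fun a1 a2 b : A =>
    \sw_(c, d <- y) \sw_(c1, c2 <- c) (S (a1 * c1) * (a2 * c2) * (S d * S b))));
      try by lin.
  apply: eq_sweedler => a b.
  transitivity (\sw_(b1, b2 <- b) \sw_(c, d <- y) \sw_(d1, d2 <- d)
      (S (a * c) * (b1 * d1) * (S d2 * S b2))); last first.
    apply: eq_sweedler => b1 b2.
    by rewrite (wh_comulA AH (f := fun c1 c2 d : A =>
      S (a * c1) * (b1 * c2) * (S d * S b2))); try by lin.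
  rewrite [RHS]exchange_sweedler; apply: eq_sweedler => c d.
  rewrite pi_l_mul (sweedler_comp _ _ _ (g := fun w => S (a * c) * w));
    last by lin.
  apply: eq_sweedler => b1 b2; rewrite -(wh_antipoder AH).
  rewrite (sweedler_comp _ _ _ (g := fun w => S (a * c) * (b1 * w * S b2)));
    last by lin.
  by apply: eq_sweedler => d1 d2; rewrite !mulrA.
transitivity (\sw_(a, b <- x) \sw_(c, d <- y) (piR (a * c) * (S d * S b))).
  apply: eq_sweedler => a b; rewrite exchange_sweedler.
  apply: eq_sweedler => c d.
  rewrite -(wh_antipodel AH).
  rewrite (wh_comulM AH (f := fun u v : A => S u * v)); try by lin.
  rewrite (sweedler_comp _ _ _ (g := fun w => w * (S d * S b))); last by lin.
  apply: eq_sweedler => a1 a2.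
  by rewrite (sweedler_comp _ _ _ (g := fun w => w * (S d * S b)));
    last by lin.
transitivity (\sw_(a, b <- x) \sw_(c, d <- y) (S c * piL d * piR a * S b)).
  apply: eq_sweedler => a b.
  transitivity (\sw_(c, d <- y) \sw_(c1, c2 <- c)
      (S c1 * piR a * c2 * S d * S b)).
    apply: eq_sweedler => c d.
    rewrite pi_r_mul (sweedler_comp _ _ _ (g := fun w => w * (S d * S b)));
      last by lin.
    by apply: eq_sweedler => c1 c2; rewrite !mulrA.
  rewrite (wh_comulA AH (f := fun c1 c2 d : A =>
    S c1 * piR a * c2 * S d * S b)); try by lin.
  apply: eq_sweedler => c d.
  rewrite -(mulrA (S c)) -pi_r_pi_l_comm -(wh_antipoder AH) mulrA.
  rewrite (sweedler_comp _ _ _ (g := fun w => S c * piR a * w * S b));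
    last by lin.
  by apply: eq_sweedler => d1 d2; rewrite !mulrA.
(* The sums over x and y now separate: S(y_(1)) piL(y_(2)) is S(y) and piR(x_(1)) S(x_(2)) is
   S(x). *)
rewrite -[S y]sweedler_antipode_pi_l -[S x]sweedler_pi_r_antipode.
rewrite [RHS](sweedler_comp _ _ _ (g := fun w =>
  (\sw_(c, d <- y) (S c * piL d)) * w)); last by lin.
apply: eq_sweedler => a b.
rewrite [RHS](sweedler_comp _ _ _ (g := fun w => w * (piR a * S b)));
  last by lin.
by apply: eq_sweedler => c d; rewrite !mulrA.
Qed.

Lemma antipode_opi_r x : S (opiR x) = piL x.
Proof.
rewrite {1}/opi_r (sweedler_comp _ _ _ SL).
(* Replace S(1_(1)) by S(1_(1)) piL(1_(2)), then split the iterated coproduct of 1 into two copies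
   of Delta(1). *)
transitivity (\sw_(u, b <- 1) \sw_(c, v <- 1)
    (eps (v * x) *: (S u * piL (b * c)))).
  rewrite (wh_comul1 AH (f := fun u c v : A =>
    eps (v * x) *: (S u * piL c))); try by lin.
  rewrite -(wh_comulA AH (f := fun u c v : A =>
    eps (v * x) *: (S u * piL c))); try by lin.
  apply: eq_sweedler => u v.
  rewrite (linear_funZ SL) -[S u]sweedler_antipode_pi_l.
  by rewrite (sweedler_comp _ _ _ (g := fun w => eps (v * x) *: w));
    last by lin.
rewrite exchange_sweedler -[RHS]sweedler1_pi_l_opi; apply: eq_sweedler => c v.
rewrite -(sweedler_comp _ _ _ (g := fun w => eps (v * x) *: w)); last by lin.
(* It remains that S(1_(1)) piL(1_(2) c) = piL(c). Expanding by [pi_l_mul] produces S(1_(1)) 1_(2) =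
   piR on the first leg, which Delta(1) absorbs. *)
congr (_ *: _).
transitivity (\sw_(u, b <- 1) \sw_(b1, b2 <- b) (S u * b1 * piL c * S b2)).
  apply: eq_sweedler => u b; rewrite pi_l_mul.
  rewrite (sweedler_comp _ _ _ (g := fun w => S u * w)); last by lin.
  by apply: eq_sweedler => b1 b2; rewrite !mulrA.
rewrite -(wh_comulA AH (f := fun u b1 b2 : A => S u * b1 * piL c * S b2));
  try by lin.
transitivity (\sw_(u, b <- 1) (piR u * piL c * S b)).
  apply: eq_sweedler => u b; rewrite -(wh_antipodel AH).
  by rewrite (sweedler_comp _ _ _ (g := fun w => w * piL c * S b));
    last by lin.
rewrite (sweedler1_pi_r (f := fun u b => u * piL c * S b)); try by lin.
by rewrite -pi_l_mul mul1r.
Qed.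

(** The chain is S(T(x)) = S(opiR(x_(1))) S(T(x_(2))) = x_(1) S(x_(2)) S(T(x_(3))) = x_(1)
    S(T(x_(3)) x_(2)) = x_(1) S(opiL(x_(2))) = x 1_(1) S(1_(2)) = x piL(1) = x. *)
Lemma antipode_right_inverse (T : A -> A) :
    linear T ->
    (forall x, \sw_(a, b <- x) (T b * a) = opiL x) ->
    (forall x, \sw_(a, b <- x) (T b * opiR a) = T x) ->
  forall x, S (T x) = x.
Proof.
move=> TL Tl Tlr x; rewrite -Tlr (sweedler_comp _ _ _ SL).
transitivity (\sw_(a, b <- x) \sw_(a1, a2 <- a) (a1 * S a2 * S (T b))).
  apply: eq_sweedler => a b.
  rewrite antipodeM antipode_opi_r -(wh_antipoder AH).
  by rewrite (sweedler_comp _ _ _ (g := fun w => w * S (T b))); last by lin.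
rewrite (wh_comulA AH (f := fun a1 a2 b : A => a1 * S a2 * S (T b)));
  try by lin.
transitivity (\sw_(a, b <- x) (a * S (opiL b))).
  apply: eq_sweedler => a b; rewrite -Tl (sweedler_comp _ _ _ SL).
  rewrite (sweedler_comp _ _ _ (g := fun w => a * w)); last by lin.
  by apply: eq_sweedler => b1 b2; rewrite antipodeM mulrA.
rewrite (sweedler_opi_l (f := fun a b => a * S b)); try by lin.
transitivity (x * piL 1); last by rewrite pi_l1 mulr1.
rewrite -(wh_antipoder AH).
rewrite (sweedler_comp _ _ _ (g := fun w => x * w)); last by lin.
by apply: eq_sweedler => u v; rewrite mulrA.
Qed.

End WeakHopfTheory.

(** * Invariant elements of a module algebra *)

Section ModuleAlgebra.
Variables (K : fieldType) (A M : algType K) (D : comultiplication A).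
Variables (eps : A -> K) (S : A -> A) (act : A -> M -> M).
Hypothesis AH : weak_hopf D eps S.
Local Notation "\sw_ ( a , b <- x ) E" := (sweedler D (fun a b => E) x).
Hypothesis actl : forall m, linear (act^~ m).
Hypothesis actM : forall a b m, act (a * b) m = act a (act b m).
Hypothesis act1 : forall m, act 1 m = m.
Hypothesis act_mul : forall a m n,
  act a (m * n) = \sw_(a1, a2 <- a) (act a1 m * act a2 n).
Hypothesis act_one : forall a, act a 1 = act (pi_l D eps a) 1.

Lemma act_opi_r1 a : act a 1 = act (opi_r D eps a) 1.
Proof. by rewrite act_one -(pi_l_opi_r AH) -act_one. Qed.

Lemma act_mul_invariantP n :
  (forall a m, act a (m * n) = act a m * n) <->
  (forall a, act a n = act (pi_l D eps a) n).
Proof.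
split=> [ninv a | ninv a m].
  by rewrite -[n]mul1r ninv act_one -ninv.
(* Letting 1 act on the right side turns it into (1_(1) a |> m)(1_(2) |> n), the shape that
   [sweedler_pi_l] produces. *)
rewrite act_mul -[RHS]act1 act_mul.
transitivity (\sw_(a1, a2 <- a) (act a1 m * act (pi_l D eps a2) n)).
  by apply: eq_sweedler => a1 a2; rewrite ninv.
rewrite (sweedler_pi_l AH (f := fun a1 a2 => act a1 m * act a2 n)); try by lin.
by apply: eq_sweedler => u v; rewrite actM.
Qed.

Lemma act_invariant_mulP n :
  (forall a m, act a (n * m) = n * act a m) <->
  (forall a, act a n = act (opi_r D eps a) n).
Proof.
split=> [ninv a | ninv a m].
  by rewrite -[n]mulr1 ninv act_opi_r1 -ninv.
rewrite act_mul -[RHS]act1 act_mul.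
transitivity (\sw_(a1, a2 <- a) (act (opi_r D eps a1) n * act a2 m)).
  by apply: eq_sweedler => a1 a2; rewrite ninv.
rewrite (sweedler_opi_r AH (f := fun a1 a2 => act a1 n * act a2 m));
  try by lin.
by apply: eq_sweedler => u v; rewrite actM.
Qed.

(** The cycle is closed by (ii) => (i) => (iv) => (iii) and (iv) => (iii) => (ii) => (i). Each
    crossing between the two pairs takes m = 1, where a, piL(a) and opiR(a) act alike. *)
Lemma act_invariantP n :
  [<-> forall a m, act a (m * n) = act a m * n;
       forall a, act a n = act (pi_l D eps a) n;
       forall a m, act a (n * m) = n * act a m;
       forall a, act a n = act (opi_r D eps a) n].
Proof.
have [i_ii ii_i] := act_mul_invariantP n.
have [iii_iv iv_iii] := act_invariant_mulP n.
split=> //; split; last split=> //.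
  move=> /ii_i ninv; apply: iv_iii => a.
  by rewrite -[n]mul1r ninv act_opi_r1 -ninv.
move=> /iv_iii ninv; apply: ii_i => a.
by rewrite -[n]mulr1 ninv act_one -ninv.
Qed.

End ModuleAlgebra.

(** A right inverse makes [f] surjective, so rank-nullity gives a zero kernel, and then [f^-1]
    cancels [f] from the left. *)
Lemma lfun_inv_right_inverse (K : fieldType) (V : vectType K) (f : 'End(V))
    (g : V -> V) : cancel g f -> (f^-1)%VF =1 g.
Proof.
move=> gK x; have kerf : lker f == 0%VS.
  rewrite -dimv_eq0 -(eqn_add2r (\dim (limg f))).
  have := limg_ker_dim f fullv; rewrite capfv => ->.
  rewrite add0n; suff -> : limg f = fullv by [].
  apply/vspaceP => y; rewrite memvf; apply/memv_imgP.
  by exists (g y); rewrite ?memvf ?gK.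
by rewrite -{1}[x]gK lker0_lfunK.
Qed.

(** * From the tensor axioms to the multilinear ones *)

Section WeakHopfOfTensor.
Variables (R : realType) (A : weakCstarHopfType R).
Implicit Types W : lmodType R[i].

Let e (i : 'I_(\dim {:A})) : A := (vbasis {:A})`_i.

Lemma linear_comul_coord (p : 'I_(\dim {:A}) * 'I_(\dim {:A})) :
  linear (fun x : A => (comul x : 'M_(_, _)) p.1 p.2 *: e p.1).
Proof. by move=> k x y; rewrite linearP !mxE scalerDl -scalerA. Qed.

(** The coefficients of Delta(x) are absorbed into the left legs, which are thus linear in x; the
    right legs are basis vectors. *)
Definition tensor_comul : comultiplication A :=
  Comultiplication (fun p => e p.2) linear_comul_coord.

Local Notation "\sw_ ( a , b <- x ) E" :=
  (sweedler tensor_comul (fun a b => E) x).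

Lemma tlift_comulE W (f : A -> A -> W) x : (forall b, linear (f^~ b)) ->
  tlift f (comul x) = sweedler tensor_comul f x.
Proof.
move=> fl; rewrite /sweedler -(pair_bigA _ (fun i j =>
  f ((comul x : 'M_(_, _)) i j *: e i) (e j))).
by apply: eq_bigr => i _; apply: eq_bigr => j _; rewrite (linear_funZ (fl _)).
Qed.

Lemma tlift_comul2E W (f : A -> A -> A -> A -> W) (g : A -> A -> A) x :
    (forall a b d, linear (fun c => f a b c d)) ->
    (forall b, linear (fun a => \sw_(c, d <- g a b) f a b c d)) ->
  tlift (fun a b => tlift (f a b) (comul (g a b))) (comul x) =
  \sw_(a, b <- x) \sw_(c, d <- g a b) f a b c d.
Proof.
move=> fl gl; rewrite -tlift_comulE //.
apply: eq_bigr => i _; apply: eq_bigr => j _; congr (_ *: _).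
by rewrite tlift_comulE.
Qed.

Let pureL (V : vectType R[i]) (v : V) : linear (fun u : A => u \ox v).
Proof. exact: pure_linearl. Qed.

Let pureR (V : vectType R[i]) (u : A) : linear (fun v : V => u \ox v).
Proof. exact: pure_linearr. Qed.

Let antipodeL : linear (@antipode R A).
Proof. by move=> k x y; rewrite linearP. Qed.

Section BilinearForms.
Variables (W : lmodType R[i]) (f : A -> A -> W).
Hypothesis fl : forall b, linear (f^~ b).
Hypothesis fr : forall a, linear (f a).

Lemma tensor_comulM x y :
  \sw_(a, b <- x * y) f a b =
  \sw_(a, b <- x) \sw_(c, d <- y) f (a * c) (b * d).
Proof.
rewrite -tlift_comulE // comulM /tmul.
rewrite (tlift_comul2E (f := fun a b c d => (a * c) \ox (b * d))); try by lin.
have fL : linear (tlift f) by move=> k s t; rewrite tlift_linear.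
rewrite (sweedler_comp _ _ _ fL); apply: eq_sweedler => a b.
rewrite (sweedler_comp _ _ _ fL); apply: eq_sweedler => c d.
by rewrite tlift_pure.
Qed.

(** [tstar] conjugates the coordinates, and the antilinear [h] undoes this. The cases used are [h]
    the star and [h] complex conjugation. *)
Lemma sweedler_star (W' : lmodType R[i]) (h : W -> W') x :
    (forall k u v, h (k *: u + v) = k^* *: h u + h v) ->
  h (\sw_(a, b <- star x) f a b) = \sw_(a, b <- x) h (f (star a) (star b)).
Proof.
move=> hL.
have h0 : h 0 = 0.
  have /eqP := hL 1 0 0; rewrite rmorph1 !scale1r addr0.
  by rewrite -subr_eq subrr eq_sym => /eqP.
have hD u v : h (u + v) = h u + h v.
  by have := hL 1 u v; rewrite rmorph1 !scale1r.
have hZ k u : h (k *: u) = k^* *: h u by rewrite -[k *: u]addr0 hL h0 addr0.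
rewrite -tlift_comulE // comul_star /tstar.
have fL : linear (tlift f) by move=> k s t; rewrite tlift_linear.
rewrite [X in tlift f X]/tlift (linear_fun_sum fL) (big_morph h hD h0).
(* [star] inside and [h] outside are both antilinear, so the composite is linear. *)
rewrite -tlift_comulE => [|b k u v]; last first.
  by rewrite starD starZ fl hL conjCK.
apply: eq_bigr => i _; rewrite (linear_fun_sum fL) (big_morph h hD h0).
apply: eq_bigr => j _.
by rewrite (linear_funZ fL) tlift_pure // hZ mxE conjCK.
Qed.

End BilinearForms.

Section TrilinearForms.
Variables (W : lmodType R[i]) (f : A -> A -> A -> W).
Hypothesis f1 : forall b c, linear (fun a => f a b c).
Hypothesis f2 : forall a c, linear (fun b => f a b c).
Hypothesis f3 : forall a b, linear (f a b).

Lemma linear_tlift3 :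
  linear (fun t : tensor A (tensor A A) => tlift (fun a => tlift (f a)) t).
Proof. by move=> k s t; rewrite tlift_linear. Qed.

Lemma tlift3_pure a b c :
  tlift (fun a => tlift (f a)) (a \ox (b \ox c)) = f a b c.
Proof.
rewrite tlift_pure; last by move=> u k s t; rewrite tlift_linear.
  by rewrite tlift_pure.
move=> w k s t; rewrite /tlift scaler_sumr -big_split; apply: eq_bigr => i _.
rewrite scaler_sumr -big_split; apply: eq_bigr => j _ /=.
by rewrite f1 scalerDr !scalerA mulrC.
Qed.

(** The linear extension of [f] to A (x) (A (x) A) is applied to both sides of coassociativity. *)
Lemma tensor_comulA x :
  \sw_(a, b <- x) \sw_(a1, a2 <- a) f a1 a2 b =
  \sw_(a, b <- x) \sw_(b1, b2 <- b) f a b1 b2.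
Proof.
have := congr1 (tlift (fun a => tlift (f a))) (comulA x).
rewrite (tlift_comul2E (f := fun a b a1 a2 => a1 \ox (a2 \ox b))); try by lin.
rewrite (tlift_comul2E (f := fun a b b1 b2 => a \ox (b1 \ox b2))); try by lin.
rewrite !(sweedler_comp _ _ _ linear_tlift3) => E.
transitivity (\sw_(a, b <- x)
  tlift (fun a => tlift (f a)) (\sw_(a1, a2 <- a) (a1 \ox (a2 \ox b)))).
  apply: eq_sweedler => a b; rewrite (sweedler_comp _ _ _ linear_tlift3).
  by apply: eq_sweedler => a1 a2; rewrite tlift3_pure.
rewrite E; apply: eq_sweedler => a b.
rewrite (sweedler_comp _ _ _ linear_tlift3).
by apply: eq_sweedler => b1 b2; rewrite tlift3_pure.
Qed.

Lemma tensor_comul1 :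
  \sw_(a, b <- 1) \sw_(c, d <- 1) f a (b * c) d =
  \sw_(a, b <- 1) \sw_(b1, b2 <- b) f a b1 b2.
Proof.
have := congr1 (tlift (fun a => tlift (f a))) (@comul1 R A).
rewrite (tlift_comul2E (f := fun a b c d => a \ox ((b * c) \ox d)));
  try by lin.
rewrite (tlift_comul2E (f := fun a b b1 b2 => a \ox (b1 \ox b2))); try by lin.
rewrite !(sweedler_comp _ _ _ linear_tlift3) => E.
transitivity (\sw_(a, b <- 1)
  tlift (fun a => tlift (f a)) (\sw_(c, d <- 1) (a \ox ((b * c) \ox d)))).
  apply: eq_sweedler => a b; rewrite (sweedler_comp _ _ _ linear_tlift3).
  by apply: eq_sweedler => c d; rewrite tlift3_pure.
rewrite E; apply: eq_sweedler => a b.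
rewrite (sweedler_comp _ _ _ linear_tlift3).
by apply: eq_sweedler => b1 b2; rewrite tlift3_pure.
Qed.

End TrilinearForms.

(** The counit as a bare function, the form that [weak_hopf] takes. *)
Definition counit_fun (x : A) : R[i] := counit x.
Local Notation eps := counit_fun.

Let epsL : scalar eps.
Proof. by move=> k u v; rewrite /eps linearP. Qed.

Let epsL' : linear (eps : A -> R[i]^o).
Proof. exact: epsL. Qed.

Let conj_antilinear (k : R[i]) (u v : R[i]^o) :
  (k *: u + v)^* = k^* *: u^* + v^* :> R[i]^o.
Proof. by rewrite rmorphD rmorphM. Qed.

Let star_antilinear (k : R[i]) (u v : A) :
  star (k *: u + v) = k^* *: star u + star v.
Proof. by rewrite starD starZ. Qed.

Lemma star1 : star (1 : A) = 1.
Proof. by rewrite -[LHS]mulr1 -{2}[1]starK -starM mulr1 starK. Qed.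

Lemma tensor_counitl (x : A) : \sw_(a, b <- x) (eps a *: b) = x.
Proof. by rewrite -[RHS]counitl tlift_comulE //; lin. Qed.

Lemma tensor_counitr (x : A) : \sw_(a, b <- x) (eps b *: a) = x.
Proof. by rewrite -[RHS]counitr tlift_comulE //; lin. Qed.

(** Uniqueness of the counit: the conjugate e'(y) of eps(y^* ) is again a right counit, and eps is a
    left one, so both equal eps(x_(1)) e'(x_(2)). *)
Lemma counit_star (x : A) : eps (star x) = (eps x)^*.
Proof.
pose e' (y : A) : R[i] := (eps (star y))^*.
have e'L : linear (e' : A -> R[i]^o).
  by move=> k u v; rewrite /e' star_antilinear epsL' conj_antilinear conjCK.
have e'x (y : A) : \sw_(a, b <- y) (e' b *: a) = y.
  rewrite -[RHS]starK -[in RHS](tensor_counitr (star y)).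
  rewrite (sweedler_star _ _ (h := star (s := A))) //; try by lin.
  by apply: eq_sweedler => a b; rewrite starZ starK.
suff E : eps x = e' x by rewrite E /e' conjCK.
transitivity (\sw_(a, b <- x) (eps a * e' b : R[i]^o)).
  rewrite -{1}[x]e'x (sweedler_comp _ _ _ epsL').
  by apply: eq_sweedler => a b; rewrite (linear_funZ epsL') mulrC.
rewrite -{2}[x]tensor_counitl (sweedler_comp _ _ _ e'L).
by apply: eq_sweedler => a b; rewrite (linear_funZ e'L).
Qed.

Let eps_mul2l (x z b : A) :
  linear (fun a => eps (x * a) * eps (b * z) : R[i]^o).
Proof. by move=> k u v; rewrite mulrDr -scalerAr epsL mulrDl -mulrA. Qed.

Let eps_mul2r (x z a : A) :
  linear (fun b => eps (x * a) * eps (b * z) : R[i]^o).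
Proof. by move=> k u v; rewrite mulrDl -scalerAl epsL mulrDr mulrCA. Qed.

Lemma tensor_counitM (x z : A) :
  \sw_(a, b <- 1) (eps (x * a) * eps (b * z) : R[i]^o) = eps (x * z).
Proof.
by rewrite -[x in RHS]mulr1 /counit_fun counitM tlift_comulE.
Qed.

Lemma sweedler_conj (f : A -> A -> R[i]^o) x :
    (forall b, linear (f^~ b)) -> (forall a, linear (f a)) ->
  (\sw_(a, b <- star x) f a b)^* =
  \sw_(a, b <- x) ((f (star a) (star b))^* : R[i]^o).
Proof.
move=> fl fr.
by rewrite (sweedler_star fl fr (h := fun u : R[i]^o => u^* : R[i]^o)).
Qed.

(** Conjugate [tensor_counitM] taken at z^* and x^*: the star reverses the products, so the legs of
    Delta(1) meet x and z in the opposite order. *)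
Lemma tensor_counitMr (x z : A) :
  \sw_(a, b <- 1) (eps (x * b) * eps (a * z) : R[i]^o) = eps (x * z).
Proof.
rewrite -[RHS]conjCK -counit_star starM -tensor_counitM -{2}star1.
rewrite sweedler_conj //.
apply: eq_sweedler => a b.
by rewrite rmorphM /= -!counit_star !starM !starK mulrC.
Qed.

(** The star fixes 1 and reverses the middle product. Scalar values are taken so that the result can
    be conjugated: [g], the conjugate of [f] on starred arguments, is again trilinear. *)
Lemma tensor_comul1r_scalar (f : A -> A -> A -> R[i]^o) :
    (forall b c, linear (fun a => f a b c)) ->
    (forall a c, linear (fun b => f a b c)) ->
    (forall a b, linear (f a b)) ->
  \sw_(a, b <- 1) \sw_(c, d <- 1) f a (c * b) d =
  \sw_(a, b <- 1) \sw_(b1, b2 <- b) f a b1 b2.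
Proof.
move=> f1 f2 f3.
pose g (a b c : A) : R[i]^o := (f (star a) (star b) (star c))^*.
have g1 b c : linear (fun a => g a b c).
  by move=> k u v; rewrite /g starD starZ f1 conj_antilinear conjCK.
have g2 a c : linear (fun b => g a b c).
  by move=> k u v; rewrite /g starD starZ f2 conj_antilinear conjCK.
have g3 a b : linear (g a b).
  by move=> k u v; rewrite /g starD starZ f3 conj_antilinear conjCK.
have gK a b c : (g (star a) (star b) (star c))^* = f a b c.
  by rewrite /g !starK conjCK.
transitivity ((\sw_(a, b <- star 1) \sw_(c, d <- star 1) g a (b * c) d)^*).
  rewrite sweedler_conj; try by lin.
  apply: eq_sweedler => a b; rewrite sweedler_conj; try by lin.
  by apply: eq_sweedler => c d; rewrite -starM gK.
rewrite star1 (tensor_comul1 g1 g2 g3) -{1}star1 sweedler_conj; try by lin.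
apply: eq_sweedler => a b; rewrite sweedler_conj; try by lin.
by apply: eq_sweedler => b1 b2; rewrite gK.
Qed.

Section TrilinearFormsRev.
Variables (W : lmodType R[i]) (f : A -> A -> A -> W).
Hypothesis f1 : forall b c, linear (fun a => f a b c).
Hypothesis f2 : forall a c, linear (fun b => f a b c).
Hypothesis f3 : forall a b, linear (f a b).

(** The scalar case, applied to each matrix entry, gives the identity in A (x) (A (x) A); the linear
    extension of [f] then carries it to [W]. *)
Lemma tensor_comul1r :
  \sw_(a, b <- 1) \sw_(c, d <- 1) f a (c * b) d =
  \sw_(a, b <- 1) \sw_(b1, b2 <- b) f a b1 b2.
Proof.
have E : \sw_(a, b <- 1) \sw_(c, d <- 1) (a \ox ((c * b) \ox d)) =
    \sw_(a, b <- 1) \sw_(b1, b2 <- b) (a \ox (b1 \ox b2)).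
  apply/matrixP => i j.
  pose entry (t : tensor A (tensor A A)) : R[i]^o := (t : 'M_(_, _)) i j.
  have entryL : linear entry by move=> k s t; rewrite /entry !mxE.
  rewrite -[LHS]/(entry _) -[RHS]/(entry _) !(sweedler_comp _ _ _ entryL).
  transitivity (\sw_(a, b <- 1) \sw_(c, d <- 1) entry (a \ox ((c * b) \ox d))).
    by apply: eq_sweedler => a b; rewrite (sweedler_comp _ _ _ entryL).
  rewrite (tensor_comul1r_scalar (f := fun a b c => entry (a \ox (b \ox c)))).
  - by apply: eq_sweedler => a b; rewrite (sweedler_comp _ _ _ entryL).
  - lin.
  - lin.
  - lin.
transitivity (tlift (fun a => tlift (f a))
    (\sw_(a, b <- 1) \sw_(c, d <- 1) (a \ox ((c * b) \ox d)))).
  rewrite (sweedler_comp _ _ _ (linear_tlift3 f)); apply: eq_sweedler => a b.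
  rewrite (sweedler_comp _ _ _ (linear_tlift3 f)); apply: eq_sweedler => c d.
  by rewrite tlift3_pure.
rewrite E (sweedler_comp _ _ _ (linear_tlift3 f)); apply: eq_sweedler => a b.
rewrite (sweedler_comp _ _ _ (linear_tlift3 f)); apply: eq_sweedler => b1 b2.
by rewrite tlift3_pure.
Qed.

End TrilinearFormsRev.

Lemma tensor_weak_hopf : weak_hopf tensor_comul eps antipode.
Proof.
split.
- exact: epsL.
- exact: antipodeL.
- by move=> *; apply: tensor_comulM.
- by move=> *; apply: tensor_comulA.
- by move=> *; apply: tensor_comul1.
- by move=> *; apply: tensor_comul1r.
- exact: tensor_counitl.
- exact: tensor_counitr.
- exact: tensor_counitM.
- exact: tensor_counitMr.
- move=> x; have := antipodel x.
  by rewrite !tlift_comulE //; lin.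
- move=> x; have := antipoder x.
  by rewrite !tlift_comulE //; lin.
- move=> x; rewrite -[RHS]antipodelr.
  rewrite (tlift_comul2E (f := fun a b b1 b2 =>
    antipode a * b1 * antipode b2)) //; lin.
Qed.

Local Notation piL := (pi_l tensor_comul eps).
Local Notation piR := (pi_r tensor_comul eps).
Local Notation opiL := (opi_l tensor_comul eps).
Local Notation opiR := (opi_r tensor_comul eps).
Local Notation AH := tensor_weak_hopf.

(** * The inverse antipode as the conjugate of the antipode by the star *)

Definition antipode_inv (x : A) : A := star (antipode (star x)).

Lemma linear_antipode_inv : linear antipode_inv.
Proof.
move=> k x y.
by rewrite /antipode_inv star_antilinear linearP star_antilinear conjCK.
Qed.

Lemma star_pi_l x : star (piL (star x)) = opiL x.
Proof.
rewrite /pi_l -star1 (sweedler_star _ _ (h := star (s := A))) //; try by lin.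
by apply: eq_sweedler => u v; rewrite starZ starK -starM counit_star conjCK.
Qed.

Lemma star_pi_r x : star (piR (star x)) = opiR x.
Proof.
rewrite /pi_r -star1 (sweedler_star _ _ (h := star (s := A))) //; try by lin.
by apply: eq_sweedler => u v; rewrite starZ starK -starM counit_star conjCK.
Qed.

(** Starring x_(1) S(x_(2)) = piL(x) at x^* reverses the factors but leaves the legs in place. *)
Lemma antipode_invl x :
  \sw_(a, b <- x) (antipode_inv b * a) = opiL x.
Proof.
rewrite -star_pi_l -(wh_antipoder AH).
rewrite (sweedler_star _ _ (h := star (s := A))) //; try by lin.
by apply: eq_sweedler => a b; rewrite starM starK.
Qed.

Lemma antipode_invr x :
  \sw_(a, b <- x) (b * antipode_inv a) = opiR x.
Proof.
rewrite -star_pi_r -(wh_antipodel AH).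
rewrite (sweedler_star _ _ (h := star (s := A))) //; try by lin.
by apply: eq_sweedler => a b; rewrite starM starK.
Qed.

Lemma antipode_inv_opi_r x :
  \sw_(a, b <- x) (antipode_inv b * opiR a) = antipode_inv x.
Proof.
have piRL : linear piR by apply: linear_sweedler_body; lin.
rewrite {2}/antipode_inv -(sweedler_pi_r_antipode AH).
rewrite (sweedler_star _ _ (h := star (s := A))) //; try by lin.
by apply: eq_sweedler => a b; rewrite starM star_pi_r.
Qed.

Lemma antipode_invK x : antipode (antipode_inv x) = x.
Proof.
exact: (antipode_right_inverse AH linear_antipode_inv antipode_invl
  antipode_inv_opi_r).
Qed.

Lemma antipode_invE x : (antipode^-1)%VF x = antipode_inv x.
Proof. exact: (lfun_inv_right_inverse antipode_invK). Qed.

End WeakHopfOfTensor.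

(** * Transfer of the equivalence to the tensor formulation *)

Theorem proposition2p3p1 (R : realType) (A : weakCstarHopfType R)
    (M : moduleAlgebraType A) (n : M) :
  [/\ forall a : A,
        (\tsum_(a1, a2 <- comul a) (a1 * antipode a2)) |> n =
        (\tsum_(u1, u2 <- comul 1) (counit (u1 * a) *: u2)) |> n,
      forall a : A,
        (\tsum_(a1, a2 <- comul a) (a2 * (antipode^-1)%VF a1)) |> n =
        (\tsum_(u1, u2 <- comul 1) (counit (u2 * a) *: u1)) |> n
    & [<-> forall (a : A) (m : M), a |> (m * n) = (a |> m) * n;
           forall a : A,
             a |> n = (\tsum_(a1, a2 <- comul a) (a1 * antipode a2)) |> n;
           forall (a : A) (m : M), a |> (n * m) = n * (a |> m);
           forall a : A,
             a |> n =
             (\tsum_(a1, a2 <- comul a) (a2 * (antipode^-1)%VF a1)) |> n]].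
Proof.
have epsL : scalar (@counit_fun R A).
  by move=> k u v; rewrite /counit_fun linearP.
have piLE (a : A) : \tsum_(u1, u2 <- comul 1) (counit (u1 * a) *: u2) =
    pi_l (tensor_comul A) (@counit_fun R A) a.
  by rewrite tlift_comulE //; lin.
have opiRE (a : A) : \tsum_(u1, u2 <- comul 1) (counit (u2 * a) *: u1) =
    opi_r (tensor_comul A) (@counit_fun R A) a.
  by rewrite tlift_comulE //; lin.
have SrE (a : A) : \tsum_(a1, a2 <- comul a) (a1 * antipode a2) =
    pi_l (tensor_comul A) (@counit_fun R A) a.
  by rewrite antipoder.
have SinvE (a : A) : \tsum_(a1, a2 <- comul a) (a2 * (antipode^-1)%VF a1) =
    opi_r (tensor_comul A) (@counit_fun R A) a.
  (* With T in place of S^-1 the sum is the star conjugate of S(a_(1)) a_(2) = piR(a), which is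
     opiR(a). *)
  rewrite -antipode_invr tlift_comulE => [|b k u v]; last first.
    by rewrite linearP mulrDr scalerAr.
  by apply: eq_sweedler => u v; rewrite antipode_invE.
have act_mul (a : A) (m m' : M) :
    a |> (m * m') =
    sweedler (tensor_comul A) (fun a1 a2 => (a1 |> m) * (a2 |> m')) a.
  rewrite hact_mul tlift_comulE // => b k u v.
  by rewrite hact_linearl mulrDl scalerAl.
have act_one (a : A) :
    a |> (1 : M) = pi_l (tensor_comul A) (@counit_fun R A) a |> 1.
  by rewrite hact_one SrE.
have [to2 [to3 [to4 to1]]] := act_invariantP (tensor_weak_hopf A)
  (hact_linearl (s := M)) (hactM (s := M)) (hact1 (s := M)) act_mul act_one n.
split=> [a|a|]; rewrite ?SrE ?SinvE ?piLE ?opiRE //.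
split; first by move=> ninv a; rewrite SrE; apply: to2.
split; first by move=> ninv; apply: to3 => a; rewrite -SrE.
split; first by move=> ninv a; rewrite SinvE; apply: to4.
by move=> ninv; apply: to1 => a; rewrite -SinvE.
Qed.
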